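(* Let $X$ be the Cantor set and suppose that $G\leq\mathrm{Homeo}(X)$ is uniformly discrete and piecewise full. The following are equivalent: (i) $G$ is ample of finite origin; (ii) given any Bratteli diagram $B=(V,E)$ associated to $G$, there exists $N\in\mathbb{N}$ such that $d(v)=d(u)$ for every $v\in V_N$ and every vertex $u\in V$ on a directed path starting at $v$; (iii) for every clopen subset $U$ of $X$, the union $\bigcup_{g\in G}g(U)$ of translates of $U$ by $G$ is clopen.
   Context: $\mathcal{B}$ is the Boolean algebra of clopen subsets of $X$. For a finite subalgebra $\mathcal{A}\le\mathcal{B}$, $\mathrm{at}(\mathcal{A})$ is its set of atoms. For $G\le \mathrm{Homeo}(X)$ and a $G$-invariant subalgebra $\mathcal{A}\le\mathcal{B}$, $\mathbf{F}_{\mathcal{A}}(G)$ is the group of all $g\in\mathrm{Homeo}(X)$ for which there are a finite partition $X=U_1\sqcup\dots\sqcup U_n$ with all $U_i\in\mathcal{A}$ and $g_1,\dots,g_n\in G$ with $g|_{U_i}=g_i|_{U_i}$; $\mathbf{F}(G):=\mathbf{F}_{\mathcal{B}}(G)$. $G$ is piecewise full on $\mathcal{A}$ if $\mathcal{A}$ is $G$-invariant and $\mathbf{F}_{\mathcal{A}}(G)=G$; $G$ is piecewise full if $\mathbf{F}(G)=G$. $G$ is ample if it is piecewise full, locally finite, countable, and $\mathrm{Fix}(g)$ is clopen for every $g\in G$. $G$ is uniformly discrete if there is a (finite) clopen partition $\mathcal{P}$ of $X$ with $|Gx\cap U|\le1$ for all $x\in X$, $U\in\mathcal{P}$. (Every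 uniformly discrete piecewise full group is ample.) $G$ is ample of finite origin if $G=\mathbf{F}(F)$ for some finite group $F<\mathrm{Homeo}(X)$ and $G$ is ample (equivalently, uniformly discrete). Bratteli diagram associated to an ample group $G$: write $G=\bigcup_{n\in\mathbb{N}}G_n$ and $\mathcal{B}=\bigcup_{n\in\mathbb{N}}\mathcal{B}_n$ as increasing unions of finite subgroups and finite subalgebras, with $G_0$ trivial, $\mathcal{B}_0=\{\emptyset,X\}$, and, for each $n$, $G_n$ piecewise full on $\mathcal{B}_n$ and the setwise stabiliser in $G_n$ of each atom of $\mathcal{B}_n$ equal to its pointwise stabiliser (such decompositions always exist). Let $\tilde V_n=\mathrm{at}(\mathcal{B}_n)$, and for $n\ge 1$ let $\tilde E_n$ contain one edge from $\tilde v\in\tilde V_{n-1}$ to $\tilde w\in\tilde V_n$ whenever $\tilde w\subseteq\tilde v$. Let $\pi_n:\tilde V_n\to V_n$ be the quotient by the $G_n$-action, and $E_{n+1}$ the quotient of $\tilde E_{n+1}$ by the induced $G_n$-action. The associated Bratteli diagram $B=(V,E)$ has $V=\bigsqcup_n V_n$ and $E=\bigsqcup_{n\ge1}E_n$, where the image in $E_{n+1}$ of an edge from $\tilde v$ to $\tilde w$ goes from $\pi_n(\tilde v)\in V_n$ to $\pi_{n+1}(\tilde w)\in V_{n+1}$. For $v\in V_n$, $d(v)=|\pi_n^{-1}(v)|$ is the number of atoms of $\mathcal{B}_n$ in the $G_n$-orbit $v$. *)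

(* Defs.v *)
From mathcomp Require Import all_boot finmap.
From mathcomp Require Import mathcomp_extra boolp classical_sets functions.
From mathcomp Require Import cardinality topology measurable_structure cantor.

Set Implicit Arguments.
Unset Strict Implicit.
Unset Printing Implicit Defensive.

Local Open Scope classical_set_scope.

(* Homeo(X) and its subgroups are sets of self-maps of X, and collections of
   subsets of X (subalgebras, orbits of atoms) are [set (set X)]. *)

Definition Homeo (X : topologicalType) : set (X -> X) :=
  [set f | continuous f /\
    exists g : X -> X, [/\ continuous g, cancel f g & cancel g f]].

Definition subgroup (X : topologicalType) (G : set (X -> X)) : Prop :=
  [/\ G `<=` @Homeo X, G id,
      (forall f g, G f -> G g -> G (f \o g)) &
      (forall f g, G f -> cancel f g -> cancel g f -> G g)].

Definition subalgebra (X : topologicalType) (A : set (set X)) : Prop :=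
  [/\ A `<=` @clopen X, A setT, setI_closed A & setC_closed A].

Definition atoms (X : Type) (A : set (set X)) : set (set X) :=
  [set a | [/\ A a, a !=set0 &
    forall b, A b -> b `<=` a -> b = set0 \/ b = a]].

Definition invariant (X : Type) (G : set (X -> X)) (A : set (set X)) : Prop :=
  forall g a, G g -> A a -> A (g @` a).

(* F_A(G) *)
Definition full_on (X : topologicalType) (A : set (set X))
    (G : set (X -> X)) : set (X -> X) :=
  [set g | @Homeo X g /\
    exists (n : nat) (U : 'I_n -> set X) (h : 'I_n -> X -> X),
      [/\ partition setT U setT, (forall i, A (U i)), (forall i, G (h i)) &
          forall i x, U i x -> g x = h i x]].

Definition full (X : topologicalType) (G : set (X -> X)) : set (X -> X) :=
  full_on (@clopen X) G.

Definition piecewise_full_on (X : topologicalType) (A : set (set X))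
    (G : set (X -> X)) : Prop :=
  invariant G A /\ full_on A G = G.

Definition piecewise_full (X : topologicalType) (G : set (X -> X)) : Prop :=
  full G = G.

Definition locally_finite (X : topologicalType) (G : set (X -> X)) : Prop :=
  forall S, finite_set S -> S `<=` G -> finite_set (smallest (@subgroup X) S).

Definition ample (X : topologicalType) (G : set (X -> X)) : Prop :=
  [/\ piecewise_full G, locally_finite G, countable G &
      forall g, G g -> clopen [set x | g x = x]].

Definition uniformly_discrete (X : topologicalType) (G : set (X -> X)) : Prop :=
  exists (n : nat) (P : 'I_n -> set X),
    [/\ partition setT P setT, (forall i, clopen (P i)) &
        forall x i, is_subset1 ([set g x | g in G] `&` P i)].

Definition ample_of_finite_origin (X : topologicalType) (G : set (X -> X)) :
    Prop :=
  (exists F, [/\ subgroup F, finite_set F & G = full F]) /\ ample G.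

Definition setwise_stab (X : Type) (G : set (X -> X)) (a : set X) :=
  [set g | G g /\ g @` a = a].

Definition pointwise_stab (X : Type) (G : set (X -> X)) (a : set X) :=
  [set g | G g /\ forall x, a x -> g x = x].

Record decomposition (X : topologicalType) (G : set (X -> X))
    (Gs : nat -> set (X -> X)) (Bs : nat -> set (set X)) : Prop := {
  dec_subgroup : forall n, subgroup (Gs n) ;
  dec_finite_group : forall n, finite_set (Gs n) ;
  dec_group_incr : forall n, Gs n `<=` Gs n.+1 ;
  dec_group_union : \bigcup_n Gs n = G ;
  dec_subalgebra : forall n, subalgebra (Bs n) ;
  dec_finite_algebra : forall n, finite_set (Bs n) ;
  dec_algebra_incr : forall n, Bs n `<=` Bs n.+1 ;
  dec_algebra_union : \bigcup_n Bs n = @clopen X ;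
  dec_group0 : Gs 0 = [set id] ;
  dec_algebra0 : Bs 0 = [set set0; setT] ;
  dec_full : forall n, piecewise_full_on (Bs n) (Gs n) ;
  dec_stab : forall n a, atoms (Bs n) a ->
    setwise_stab (Gs n) a = pointwise_stab (Gs n) a }.

(* [edges n] joins [vertices n] to [vertices n.+1], so it is E_{n+1}; a vertex
   of the diagram is a level together with a member of that level. The
   proposition [joins n e v w] says that e goes from v to w. *)
Record bratteli (TV TE : Type) := Bratteli {
  vertices : nat -> set TV ;
  edges : nat -> set TE ;
  joins : nat -> TE -> TV -> TV -> Prop }.

Inductive dpath (TV TE : Type) (B : bratteli TV TE) (n : nat) (v : TV) :
    nat -> TV -> Prop :=
| dpath_nil : vertices B n v -> dpath B n v n v
| dpath_rcons m w e u :
    dpath B n v m w -> edges B m e -> vertices B m.+1 u -> joins B m e w u ->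
    dpath B n v m.+1 u.

Section AssociatedDiagram.
Variables (X : topologicalType).
Variables (Gs : nat -> set (X -> X)) (Bs : nat -> set (set X)).

Definition tvertices (n : nat) : set (set X) := atoms (Bs n).

Definition tedges (n : nat) : set (set X * set X) :=
  [set p | [/\ tvertices n p.1, tvertices n.+1 p.2 & p.2 `<=` p.1]].

(* Points of a quotient by G_n are G_n-orbits. *)
Definition vclass (n : nat) (a : set X) : set (set X) :=
  [set g @` a | g in Gs n].

Definition eclass (n : nat) (p : set X * set X) : set (set X * set X) :=
  [set (g @` p.1, g @` p.2) | g in Gs n].

Definition associated_bratteli : bratteli (set (set X)) (set (set X * set X)) :=
  {| vertices n := vclass n @` tvertices n ;
     edges n := eclass n @` tedges n ;
     joins n e v w := exists p, [/\ tedges n p, eclass n p = e,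
       vclass n p.1 = v & vclass n.+1 p.2 = w] |}.

Definition vdeg (n : nat) (v : set (set X)) : nat :=
  #|` fset_set [set a | tvertices n a /\ vclass n a = v]|%fset.

End AssociatedDiagram.

(* Main.v *)
(* Let the clopen pieces of a uniformly discrete partition be indexed by idx,
   so that idx is locally constant and injective on every G-orbit.  A group of
   elements of G respecting a finite labelling of X that refines idx is then
   finite, since each of its elements is determined by its effect on the labels.

   (i) => (ii): in a decomposition, the equality of setwise and pointwise
   stabilisers gives d(v) = |G_n x| for every x in an atom of the orbit v.  If
   G = F(F) with F finite, then F is contained in some G_N, so all G_n with
   n >= N have the G-orbits as orbits.
   (ii) => (iii): a decomposition exists, and the constancy of d along the path
   of the cells containing x says that G_N x = G x.  So the union of the
   G-translates of U is the union of its finitely many G_N-translates.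
   (iii) => (i): the set of indices met by the orbit of x is a locally constant
   function of x.  Hence exchanging the points of index i and j in each orbit
   meeting both pieces is an element of G.  These swaps respect the labelling
   by orbit type and index, so they lie in a finite subgroup of G, and every
   element of G agrees locally with a swap. *)

Require Import Defs.
From mathcomp Require Import all_boot finmap.
From mathcomp Require Import mathcomp_extra boolp classical_sets functions.
From mathcomp Require Import cardinality topology measurable_structure cantor.
From mathcomp Require Import perm.

Local Open Scope classical_set_scope.

Set Implicit Arguments.
Unset Strict Implicit.
Unset Printing Implicit Defensive.

(** * Finiteness of sets *)

Lemma finite_subsets (T : Type) (A : set T) :
  finite_set A -> finite_set [set B | B `<=` A].
Proof.
elim/Pchoice: T => T in A *.
move=> /finite_fsetP[D ->].
apply: sub_finite_set (finite_image (fun Y : {fset T} => [set` Y])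
  (finite_fset (fpowerset D))).
move=> B BD; have Bfin := sub_finite_set BD (finite_fset D).
exists (fset_set B); last exact: fset_setK.
rewrite /= fpowersetE; apply/fsubsetP => x.
by rewrite in_fset_set// inE => /BD.
Qed.

Lemma finite_injective (T U : Type) (S : set T) (B : set U) (f : T -> U) :
  finite_set B -> f @` S `<=` B -> {in S &, injective f} -> finite_set S.
Proof.
move=> finB fSB finj; rewrite -(eq_finite_set (inj_card_eq finj)).
exact: sub_finite_set fSB finB.
Qed.

Lemma finite_sub_bigcup_incr (T : Type) (A : nat -> set T) (F : set T) :
  (forall n, A n `<=` A n.+1) -> finite_set F -> F `<=` \bigcup_n A n ->
  exists N, F `<=` A N.
Proof.
move=> incr finF FA.
have mono m n : (m <= n)%N -> A m `<=` A n.
  by move=> /subnK <-; elim: (n - m)%N => //= k IH x /IH /incr.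
have /choice[e eP] : forall x, exists n, F x -> A n x.
  move=> x; have [Fx|nFx] := pselect (F x); last by exists 0.
  by have [n _ Anx] := FA _ Fx; exists n.
have /finite_fsetP[D DE] := finite_image e finF.
exists (\max_(n <- D) n) => x Fx; apply: (mono (e x)); last exact: eP.
have : (e x) \in D by have : (e @` F) (e x) by [exists x]; rewrite DE.
by move=> /(@leq_bigmax_seq _ _ xpredT id _)-/(_ isT).
Qed.

(** * Groups of homeomorphisms and algebras of clopen sets *)

Section Homeomorphisms.
Variable X : topologicalType.
Implicit Types (A : set (set X)) (G : set (X -> X)) (f g h : X -> X).

Lemma Homeo_comp f g : Homeo f -> Homeo g -> Homeo (f \o g).
Proof.
move=> [cf [f' [cf' fK f'K]]] [cg [g' [cg' gK g'K]]]; split.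
  by move=> x; apply: continuous_comp; [exact: cg|exact: cf].
exists (g' \o f'); split; first by
  move=> x; apply: continuous_comp; [exact: cf'|exact: cg'].
- exact: can_comp.
- exact: can_comp.
Qed.

Lemma subgroup_inv G g : subgroup G -> G g ->
  exists h, [/\ G h, cancel g h & cancel h g].
Proof.
move=> [GH _ _ GV] Gg; have [_ [h [_ gK hK]]] := GH _ Gg.
by exists h; split => //; exact: GV Gg gK hK.
Qed.

(** An intersection of subgroups containing [S] consists of homeomorphisms once there is at least
    one such subgroup, here [G]. *)
Lemma subgroup_smallest G S : subgroup G -> S `<=` G ->
  subgroup (smallest (@subgroup X) S).
Proof.
move=> sG SG; split.
- by move=> f /(_ _ (conj sG SG)); case: sG => + _ _ _; apply.
- by move=> H [[]].
- move=> f g Sf Sg H HS; case: (HS) => -[_ _ + _] _.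
  by apply; [exact: Sf|exact: Sg].
- move=> f g Sf fK gK H HS; case: (HS) => -[_ _ _ +] _; apply; last exact: gK.
    by apply: (Sf).
  by [].
Qed.

Lemma subgroup1 : subgroup [set @id X].
Proof.
have H1 : Homeo (@id X).
  by split=> [x|]; [|exists id; split=> // x]; exact: cvg_id.
split=> //.
- by move=> _ ->.
- by move=> _ _ -> ->.
- by move=> _ g -> idK _; apply/funext => x; exact: idK.
Qed.

Lemma image_cancel g h (U : set X) : cancel g h -> cancel h g ->
  g @` U = h @^-1` U.
Proof.
move=> gK hK; apply/seteqP; split => [_ [x Ux <-]|x Ux] /=; first by rewrite gK.
by exists (h x) => //; rewrite hK.
Qed.

Lemma Homeo_image_clopen g (U : set X) : Homeo g -> clopen U -> clopen (g @` U).
Proof.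
move=> [_ [h [ch gK hK]]] cU; rewrite (image_cancel _ gK hK).
exact: preimage_clopen.
Qed.

Lemma clopen_subalgebra : subalgebra (@clopen X).
Proof.
by split => //; [exact: clopenT|exact: clopenI|move=> A; exact: (clopenC setT)].
Qed.

Lemma subalgebra_fin_bigcap A : subalgebra A -> fin_bigcap_closed A.
Proof.
move=> [_ AT AI AC] I D V finD DV.
rewrite -[X in A X]setCK setC_bigcap; apply: (AC).
suff /fin_bigcup_closedP : A set0 /\ setU_closed A.
  by apply => // i Di; apply: (AC); exact: DV.
split; first by rewrite -setCT; exact: AC.
by move=> U W AU AW; rewrite -[_ `|` _]setCK setCU; apply/AC/AI; exact: AC.
Qed.

End Homeomorphisms.

(** * Cells of a family of subsets *)

Section Cells.
Variable X : Type.
Implicit Types (C : set (set X)) (x y : X).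

(** For finite [C], the cells are the atoms of the algebra generated by [C]. *)
Definition cell C x : set X := [set y | forall S, C S -> (S x <-> S y)].

(** These are the unions of cells; for finite [C] they form the algebra generated by [C]. *)
Definition saturated C : set (set X) :=
  [set V | forall x y, cell C x y -> V x -> V y].

Lemma cell_refl C x : cell C x x. Proof. by []. Qed.

Lemma cell_sym C x y : cell C x y -> cell C y x.
Proof. by move=> xy S CS; have := xy _ CS; tauto. Qed.

Lemma cell_eq C x y : cell C x y -> cell C x = cell C y.
Proof.
move=> xy; apply/seteqP; split => z xz S CS;
  by have := xy _ CS; have := xz _ CS; tauto.
Qed.

Lemma cell_bigcap C x :
  cell C x = \bigcap_(S in C) (if `[< S x >] then S else ~` S).
Proof.
apply/seteqP; split => y xy S CS.
  by case: asboolP => [/(xy _ CS)//|nSx /(xy _ CS)].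
by have := xy _ CS; case: asboolP => //= ? ?; split.
Qed.

Lemma finite_cells C : finite_set C -> finite_set (range (cell C)).
Proof.
move=> finC.
(* A cell is determined by the members of [C] that contain it; [f] recovers it from them. *)
pose f (D : set (set X)) : set X := [set y | forall S, C S -> (D S <-> S y)].
apply: sub_finite_set (finite_image f (finite_subsets finC)).
move=> _ [x _ <-]; exists [set S | C S /\ S x]; first by move=> S [].
by apply/seteqP; split => y xy S CS; have := xy _ CS; rewrite /=; tauto.
Qed.

Lemma finite_saturated C : finite_set C -> finite_set (saturated C).
Proof.
move=> /finite_cells /finite_subsets.
move=> /(finite_image (fun D => \bigcup_(W in D) W)).
apply: sub_finite_set => V satV; exists (cell C @` V).
  by move=> _ [x _ <-]; exists x.
apply/seteqP; split => [y [_ [x Vx <-]] /satV|x Vx]; first exact.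
by exists (cell C x) => //; exists x.
Qed.

Lemma sub_saturated C : C `<=` saturated C.
Proof. by move=> S CS x y /(_ _ CS)[]. Qed.

Lemma saturated_incr C D : C `<=` D -> saturated C `<=` saturated D.
Proof. by move=> CD V satV x y xy; apply: satV => S /CD; exact: xy. Qed.

Lemma saturated0 : saturated set0 = [set set0; setT].
Proof.
apply/seteqP; split => [V satV|V [] ->//].
have [[x Vx]|/set0P/negP/negPn/eqP ->] := pselect (V !=set0); last by left.
by right; apply/seteqP; split => // y _; exact: (satV x).
Qed.

End Cells.

Section Saturated.
Variable X : topologicalType.

(** Cells of a finite clopen family are clopen, so unions of cells are open; the complement of such
    a union is again one, so it is also closed. *)
Lemma saturated_subalgebra (C : set (set X)) :
  finite_set C -> C `<=` @clopen X -> subalgebra (saturated C).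
Proof.
move=> finC Cclopen; split => //.
- have opn V : saturated C V -> open V.
    move=> satV; rewrite openE => x Vx; rewrite /interior.
    apply: (@filterS _ _ _ (cell C x)); first by move=> y xy; exact: satV xy Vx.
    apply: open_nbhs_nbhs; split; last exact: cell_refl.
    suff [] : clopen (cell C x) by [].
    rewrite cell_bigcap.
    apply: (subalgebra_fin_bigcap (clopen_subalgebra X)) => // S CS.
    by case: asboolP => _; [|apply: (clopenC setT)]; exact: Cclopen.
  move=> V satV; split; first exact: opn.
  rewrite -[V]setCK; apply/open_closedC/opn => x y xy nVx Vy.
  exact: nVx (satV _ _ (cell_sym xy) Vy).
- by move=> U V satU satV x y xy [/(satU _ _ xy)? /(satV _ _ xy)].
- by move=> V satV x y xy nVx Vy; exact: nVx (satV _ _ (cell_sym xy) Vy).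
Qed.

Lemma saturated_invariant (C : set (set X)) (G : set (X -> X)) :
  subgroup G -> Defs.invariant G C -> Defs.invariant G (saturated C).
Proof.
move=> sG GC g V Gg satV; have [h [Gh gK hK]] := subgroup_inv sG Gg.
rewrite (image_cancel _ gK hK) => x y xy /=; apply: satV => S CS.
have := xy _ (GC _ _ Gg CS).
by rewrite (image_cancel _ gK hK).
Qed.

End Saturated.

(** * Maps agreeing locally with elements of a group *)

Section LocallyIn.
Variable X : topologicalType.
Implicit Types (A : set (set X)) (G H : set (X -> X)) (f g h : X -> X).

(** A pointwise form of [full_on] that avoids handling partitions. The two agree for a finite
    subalgebra, and for the clopen algebra of a compact space. *)
Definition locally_in A G : set (X -> X) :=
  [set g | Homeo g /\ forall x, exists U h,
    [/\ A U, U x, G h & forall y, U y -> g y = h y]].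

Lemma sub_locally_in A G : A setT -> G `<=` @Homeo X -> G `<=` locally_in A G.
Proof. by move=> AT GH g Gg; split; [exact: GH|move=> x; exists setT, g]. Qed.

Lemma locally_in_incr A B G H : A `<=` B -> G `<=` H ->
  locally_in A G `<=` locally_in B H.
Proof.
move=> AB GH g [Hg gloc]; split=> // x; have [U [h [AU Ux Gh gh]]] := gloc x.
by exists U, h; split => //; [exact: AB|exact: GH].
Qed.

Lemma locally_in_idem A G : setI_closed A ->
  locally_in A (locally_in A G) `<=` locally_in A G.
Proof.
move=> AI g [Hg gloc]; split=> // x; have [U [h [AU Ux [_ hloc] gh]]] := gloc x.
have [V [k [AV Vx Gk hk]]] := hloc x.
exists (U `&` V), k; split => //; first exact: AI.
by move=> y [/gh -> /hk].
Qed.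

Lemma locally_in_subgroup A G : subalgebra A -> subgroup G ->
  Defs.invariant G A -> subgroup (locally_in A G).
Proof.
move=> [_ AT AI _] sG GA; have [GH G1 GM GV] := sG; split.
- by move=> g [].
- exact: sub_locally_in.
- move=> f g [Hf floc] [Hg gloc]; split; first exact: Homeo_comp.
  move=> x; have [U [h [AU Ux Gh gh]]] := gloc x.
  have [V [k [AV Vx Gk fk]]] := floc (g x).
  have [h' [Gh' hK h'K]] := subgroup_inv sG Gh.
  (* This is the part of [U] that [h] sends into [V]; invariance of [A] keeps it in [A]. *)
  exists (U `&` (h' @` V)), (k \o h); split => //.
  + by apply: AI => //; exact: GA.
  + by split => //; exists (g x) => //; rewrite gh.
  + exact: GM.
  + by move=> y [/gh gy [z Vz zy]] /=; rewrite gy fk// -zy h'K.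
- move=> f g [Hf floc] fK gK; split.
    have [cf [f' [cf' f'K fK']]] := Hf.
    suff -> : g = f' by split=> //; exists f; split.
    by apply/funext => x; rewrite -[x in RHS]gK f'K.
  move=> x; have [U [h [AU Ux Gh fh]]] := floc (g x).
  have [h' [Gh' hK h'K]] := subgroup_inv sG Gh.
  exists (h @` U), h'; split => //; first exact: GA.
    by exists (g x) => //; rewrite -fh.
  by move=> _ [z Uz <-]; rewrite hK -fh// fK.
Qed.

Lemma full_on_locally_in A G : full_on A G `<=` locally_in A G.
Proof.
move=> g [Hg [n [U [h [[cU _ _] AU Gh gh]]]]]; split => // x.
have [i _ Uix] : cover setT U x by rewrite cU.
by exists (U i), (h i); split => // y; exact: gh.
Qed.

(** The cells of the finite cover [C] partition the space and refine the cover, so on each of them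
    [g] agrees with one element of [G]. *)
Lemma finite_cover_full_on A G C g : subalgebra A -> Homeo g ->
  finite_set C -> C `<=` A -> (forall x, exists2 V, C V & V x) ->
  (forall V, C V -> exists2 h, G h & forall y, V y -> g y = h y) ->
  full_on A G g.
Proof.
move=> sA Hg finC CA covC Ch; split => //.
have [D DE] := finite_fsetP.1 (finite_cells finC).
have cellD x : cell C x \in D.
  by have : range (cell C) (cell C x) by [exists x]; rewrite DE.
have Dcell (i : 'I_(size D)) : exists x, nth set0 D i = cell C x.
  have : [set` D] (nth set0 D i) by rewrite /= mem_nth.
  by rewrite -DE => -[x _ <-]; exists x.
pose U (i : 'I_(size D)) := nth set0 D i.
have Uh i : exists2 h, G h & forall y, U i y -> g y = h y.
  have [x Uix] := Dcell i; have [V CV Vx] := covC x.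
  have [h Gh gh] := Ch _ CV; exists h => // y.
  by rewrite /U Uix => /(_ _ CV)[/(_ Vx) /gh].
have {Uh} /choice[h hP] :
    forall i, exists h, G h /\ forall y, U i y -> g y = h y.
  by move=> i; have [h] := Uh i; exists h.
exists (size D), U, h; split; last 2 first.
- by move=> i; have [] := hP i.
- by move=> i; have [] := hP i.
- split.
  + apply/seteqP; split => // x _.
    have xD : (index (cell C x) D < size D)%N by rewrite index_mem.
    by exists (Ordinal xD) => //; rewrite /U /= nth_index.
  + move=> i j _ _ [x []]; rewrite /U => Uix Ujx.
    apply/val_inj/eqP.
    rewrite -(nth_uniq set0 (ltn_ord i) (ltn_ord j) (fset_uniq D)).
    have [y yE] := Dcell i; have [z zE] := Dcell j.
    rewrite yE zE (cell_eq (C := C) (x := y) (y := x)) -?yE//.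
    by rewrite (cell_eq (C := C) (x := z) (y := x)) -?zE.
  + by move=> i _; have [x] := Dcell i; rewrite /U => ->; exists x.
- move=> i; have [x] := Dcell i; rewrite /U => ->; rewrite cell_bigcap.
  apply: (subalgebra_fin_bigcap sA) => // S CS; have [_ _ _ AC] := sA.
  by case: asboolP => _; [|apply: (AC)]; exact: CA.
Qed.

Lemma finite_full_onE A G : subalgebra A -> finite_set A ->
  full_on A G = locally_in A G.
Proof.
move=> sA finA; apply/seteqP; split; first exact: full_on_locally_in.
move=> g [Hg gloc].
pose C := [set U | A U /\ exists2 h, G h & forall y, U y -> g y = h y].
apply: (@finite_cover_full_on _ _ C) => //.
- by apply: sub_finite_set finA => U [].
- by move=> U [].
- move=> x; have [U [h [AU Ux Gh gh]]] := gloc x.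
  by exists U => //; split => //; exists h.
- by move=> U [].
Qed.

Lemma finite_locally_in A G : finite_set A -> finite_set G ->
  finite_set (locally_in A G).
Proof.
move=> finA finG.
(* [F g] lists the pieces in [A] with the elements of [G] that [g] agrees with there; for [g]
   locally in [G] these pieces cover, so [F g] determines [g]. *)
pose F g : set (set X * (X -> X)) :=
  [set p | [/\ A p.1, G p.2 & forall y, p.1 y -> g y = p.2 y]].
apply: (finite_injective (f := F) (finite_subsets (finite_setX finA finG))).
  by move=> _ [g _ <-] p [].
move=> g g' /set_mem[_ gloc] _ Fgg'; apply/funext => x.
have [U [h [AU Ux Gh gh]]] := gloc x.
have : F g (U, h) by [].
by rewrite Fgg' gh// => -[_ _ ->].
Qed.

End LocallyIn.

Lemma saturated_locally_in_invariant (X : topologicalType) (C : set (set X))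
    (G : set (X -> X)) :
  subgroup G -> Defs.invariant G C ->
  Defs.invariant (locally_in (saturated C) G) (saturated C).
Proof.
move=> sG GC g V [_ gloc] satV x y xy [u Vu ux].
have [U [h [satU Uu Gh gh]]] := gloc u.
(* Cutting [V] down to a piece where [g] is a single [h] of [G] reduces the claim to invariance
   under [h]. *)
have satUV : saturated C (U `&` V).
  by move=> a b ab [/(satU _ _ ab)? /(satV _ _ ab)].
have [] := saturated_invariant sG GC Gh satUV xy.
  by exists u => //; rewrite -gh.
by move=> v [Uv Vv] <-; exists v => //; exact: gh.
Qed.

(** * Piecewise full groups on compact zero-dimensional spaces *)

Section StoneSpace.
Variable X : ptopologicalType.
Hypothesis cptX : compact [set: X].
Hypothesis clopen_nbhs : forall (x : X) (U : set X), nbhs x U ->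
  exists2 V, clopen V & V x /\ V `<=` U.
Implicit Types (G H : set (X -> X)) (f g h : X -> X).

(** Compactness extracts a finite subcover from the clopen sets on which [g] agrees with an element
    of [G]. *)
Lemma fullE G : full G = locally_in (@clopen X) G.
Proof.
apply/seteqP; split; first exact: full_on_locally_in.
move=> g [Hg gloc].
pose C := [set U | clopen U /\ exists2 h, G h & forall y, U y -> g y = h y].
have : cover_compact [set: X] by rewrite -compact_cover.
move=> /(_ _ C id)[U [[]]//|x _|D DC covD].
  have [U [h [cU Ux Gh gh]]] := gloc x.
  by exists U => //; split => //; exists h.
apply: (@finite_cover_full_on _ _ _ [set` D]) => //.
- exact: clopen_subalgebra.
- by move=> U /DC /set_mem[].
- by move=> x; have [U DU Ux] := covD x I; exists U.
- by move=> U /DC /set_mem[].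
Qed.

Lemma locally_in_near G g : Homeo g ->
  (forall x : X, exists2 h, G h & \forall y \near x, g y = h y) ->
  locally_in (@clopen X) G g.
Proof.
move=> Hg gloc; split=> // x; have [h Gh /clopen_nbhs[V cV [Vx gh]]] := gloc x.
by exists V, h.
Qed.
End StoneSpace.

Lemma clopen_near (X : topologicalType) (A : set X) :
  (forall x : X, \forall y \near x, A y <-> A x) -> clopen A.
Proof.
have opn (B : set X) : (forall x : X, \forall y \near x, B y <-> B x) -> open B.
  move=> nB; rewrite openE => x Bx; rewrite /interior.
  by apply: filterS (nB x) => y [_]; exact.
move=> nA; split; first exact: opn.
rewrite -[A]setCK; apply/open_closedC/opn => x.
by apply: filterS (nA x) => y /=; tauto.
Qed.

Lemma near_clopen (X : topologicalType) (A : set X) : clopen A ->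
  forall x : X, \forall y \near x, A y <-> A x.
Proof.
move=> [oA /closed_openC cA] x; have [Ax|nAx] := pselect (A x).
  by apply: filterS (open_nbhs_nbhs (conj oA Ax)).
by apply: filterS (open_nbhs_nbhs (conj cA nAx)).
Qed.

Lemma continuous_near (X : topologicalType) (f : X -> X) :
  (forall x : X, exists2 h, continuous h & \forall y \near x, f y = h y) ->
  continuous f.
Proof.
move=> floc x; have [h ch fh] := floc x.
rewrite /continuous_at (nbhs_singleton fh).
apply: cvg_trans (ch x); apply: near_eq_cvg.
by apply: filterS fh => y ->.
Qed.

(** * Uniformly discrete groups through the index of a point *)

Lemma uniformly_discrete_index (X : topologicalType) (G : set (X -> X)) :
  subgroup G -> uniformly_discrete G -> exists (n : nat) (idx : X -> 'I_n),
    (forall x : X, \forall y \near x, idx y = idx x) /\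
    (forall g x, G g -> idx (g x) = idx x -> g x = x).
Proof.
move=> [_ Gid _ _] [n [P [[cP tP _] clP Psub]]].
have /choice[idx idxP] : forall x, exists i, P i x.
  by move=> x; have [i _ Pix] : cover setT P x by [rewrite cP]; exists i.
have idxE i x : P i x -> idx x = i.
  by move=> Pix; apply: tP => //; exists x.
exists n, idx; split.
  move=> x; apply: filterS (near_clopen (clP (idx x)) x) => y [_ /(_ (idxP x))].
  exact: idxE.
move=> g x Gg gx; apply: (Psub x (idx x)).
  by split; [exists g|rewrite -gx].
by split; [exists id|].
Qed.

Section OrbitIndex.
Variables (X : ptopologicalType) (G : set (X -> X)) (n : nat) (idx : X -> 'I_n).
Hypothesis sG : subgroup G.
Hypothesis near_idx : forall x : X, \forall y \near x, idx y = idx x.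
Hypothesis idx_fix : forall g x, G g -> idx (g x) = idx x -> g x = x.
Implicit Types (g h : X -> X) (x y : X).

Let GH : G `<=` @Homeo X. Proof. by case: sG. Qed.
Let GM g h : G g -> G h -> G (g \o h).
Proof. by case: sG => _ _ + _; exact. Qed.

Lemma idx_inj g h x : G g -> G h -> idx (g x) = idx (h x) -> g x = h x.
Proof.
move=> Gg Gh ghx; have [h' [Gh' hK h'K]] := subgroup_inv sG Gh.
rewrite -[x in LHS]hK; apply: (idx_fix (g := g \o h')); first exact: GM.
by rewrite /= hK.
Qed.

Lemma near_idx_comp g x : G g -> \forall y \near x, idx (g y) = idx (g x).
Proof. by move=> /GH[cg _]; exact: (cg x _ (near_idx (g x))). Qed.

(** A point is fixed exactly when [g] preserves its index, and the indices of [x] and of [g x] are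
    both locally constant. *)
Lemma clopen_fix g : G g -> clopen [set x | g x = x].
Proof.
move=> Gg; apply: clopen_near => x /=.
near=> y.
have gy : idx (g y) = idx (g x) by near: y; exact: near_idx_comp.
have yx : idx y = idx x by near: y; exact: near_idx.
by split => fixy; apply: idx_fix => //; [rewrite -gy fixy|rewrite gy fixy].
Unshelve. all: by end_near. Qed.

Lemma clopen_idx i : clopen (idx @^-1` [set i]).
Proof. by apply: clopen_near => x; apply: filterS (near_idx x) => y /= ->. Qed.

Lemma countable_idx : countable (@clopen X) -> countable G.
Proof.
move=> ctbl.
(* An element of [G] is determined by the preimages of the pieces, and there are only countably many
   finite families of indexed clopen sets. *)
pose F g : set ('I_n * set X) :=
  range (fun i => (i, g @^-1` (idx @^-1` [set i]))).
have Finj : {in G &, injective F}.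
  move=> g h /set_mem Gg /set_mem Gh Fgh; apply/funext => x.
  apply: idx_inj => //.
  have : F g (idx (g x), g @^-1` (idx @^-1` [set idx (g x)])).
    by exists (idx (g x)).
  rewrite Fgh => -[_ _ [-> /esym E]].
  by have : (g @^-1` (idx @^-1` [set idx (g x)])) x by []; rewrite E.
have cX : countable ([set: 'I_n] `*` @clopen X).
  by apply: countableX => //; exact: countableP.
rewrite -(eq_countable (inj_card_eq Finj)).
apply: sub_countable (countable_finite_subset cX); apply: subset_card_le.
move=> _ [g Gg <-]; split; last by apply: finite_image; exact: finite_finset.
move=> _ [i _ <-]; split => //=; have [cg _] := GH Gg.
by apply: preimage_clopen cg; exact: clopen_idx.
Qed.

Section LabelStabilizer.
Variables (L : Type) (l : X -> L).
Hypothesis finl : finite_set (range l).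
Hypothesis l_idx : forall x y, l x = l y -> idx x = idx y.

(** These elements permute the fibres of [l]. *)
Definition label_stab : set (X -> X) :=
  [set g | G g /\ forall x y, l (g x) = l (g y) <-> l x = l y].

Lemma label_stab_subgroup : subgroup label_stab.
Proof.
split.
- by move=> g [/GH].
- by split => //; case: sG.
- move=> f g [Gf lf] [Gg lg]; split; first exact: GM.
  by move=> x y; rewrite /= lf lg.
- move=> f g [Gf lf] fK gK; split; first by case: sG => _ _ _; apply; eauto.
  by move=> x y; rewrite -lf !gK.
Qed.

Lemma finite_label_stab : finite_set label_stab.
Proof.
(* [F g] is the graph of a function from labels to indices: equal labels stay equal under [g], and
   labels refine [idx]. *)
pose F g : set (L * 'I_n) := range (fun x => (l x, idx (g x))).
apply: (finite_injective (f := F)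
  (finite_subsets (finite_setX finl (finite_finset (X := [set: 'I_n]))))).
  by move=> _ [g _ <-] _ [x _ <-]; split => //; exists x.
move=> g h /set_mem[Gg lg] /set_mem[Gh lh] Fgh; apply/funext => x.
apply: idx_inj => //.
have : F g (l x, idx (g x)) by exists x.
by rewrite Fgh => -[y _ [/lh/l_idx <- ->]].
Qed.

End LabelStabilizer.

(* The label of [x] is its index together with the action of [S] on the
   indices of the orbit of [x]. *)
Lemma locally_finite_idx : locally_finite G.
Proof.
move=> S finS SG.
pose c x : set ((X -> X) * ('I_n * 'I_n)) := [set t | S t.1 /\
  exists g, [/\ G g, idx (g x) = t.2.1 & idx (t.1 (g x)) = t.2.2]].
pose l x := (c x, idx x).
have c_inv g x : G g -> c (g x) = c x.
  have cS h y : G h -> c (h y) `<=` c y.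
    move=> Gh t [St [k [Gk k1 k2]]]; split=> //; exists (k \o h).
    by split => //; exact: GM.
  move=> Gg; apply/seteqP; split; first exact: cS.
  by have [h [Gh gK _]] := subgroup_inv sG Gg; rewrite -{1}[x]gK; exact: cS.
apply: (@sub_finite_set _ _ (label_stab l)); last first.
  apply: finite_label_stab; last by move=> x y [].
  apply: sub_finite_set (finite_setX (finite_subsets (finite_setX finS
    (finite_finset (X := [set: 'I_n * 'I_n]))))
    (finite_finset (X := [set: 'I_n]))).
  by move=> _ [x _ <-]; split => // t [].
apply: smallest_sub; first exact: label_stab_subgroup.
move=> s Ss; have Gs := SG _ Ss; split => // x y; rewrite /l !c_inv//.
have Gid : G id by case: sG.
(* In both directions, equality of [c x] and [c y] realises the pair of indices of [x] and [s x] at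
   some [g y]; injectivity of [idx] on the orbit then forces [g y] to be [y]. *)
split => -[cxy ixy]; congr pair => //.
- have : c x (s, (idx x, idx (s x))) by split => //; exists id.
  rewrite cxy => -[_ [g [Gg /= gy sgy]]].
  have [h [_ sK _]] := subgroup_inv sG Gs.
  rewrite -gy -[g y]sK -[y in RHS]sK; congr (idx (h _)).
  by apply: (@idx_inj (s \o g) s) => //; [exact: GM|rewrite /= sgy].
- have : c x (s, (idx x, idx (s x))) by split => //; exists id.
  rewrite cxy => -[_ [g [Gg /= gy <-]]].
  by rewrite (idx_fix Gg) // gy.
Qed.

Definition orbit_type x : set 'I_n := [set i | exists2 g, G g & idx (g x) = i].

Lemma orbit_type_inv g x : G g -> orbit_type (g x) = orbit_type x.
Proof.
have sub h y : G h -> orbit_type (h y) `<=` orbit_type y.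
  by move=> Gh _ [k Gk <-]; exists (k \o h) => //; exact: GM.
move=> Gg; apply/seteqP; split; first exact: sub.
by have [h [Gh gK _]] := subgroup_inv sG Gg; rewrite -{1}[x]gK; exact: sub.
Qed.

(** The points whose orbit meets the piece of index [i] form the union of the translates of that
    piece, clopen by assumption; there are finitely many [i]. *)
Lemma near_orbit_type :
  (forall U, clopen U -> clopen (\bigcup_(g in G) g @` U)) ->
  forall x, \forall y \near x, orbit_type y = orbit_type x.
Proof.
move=> cG x.
have typeE i :
    [set y | orbit_type y i] = \bigcup_(g in G) g @` (idx @^-1` [set i]).
  apply/seteqP; split => [y [g Gg gy]|y [g Gg [z zi <-]]].
    have [h [Gh gK hK]] := subgroup_inv sG Gg.
    by exists h => //; exists (g y).
  have [h [Gh gK hK]] := subgroup_inv sG Gg.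
  by exists h => //; rewrite gK.
have near_i i : \forall y \near x, orbit_type y i <-> orbit_type x i.
  apply: (near_clopen (A := [set y | orbit_type y i])); rewrite typeE.
  exact/cG/clopen_idx.
near=> y; apply/seteqP.
suff yx i : orbit_type y i <-> orbit_type x i by split => i /yx.
move: i; near: y; exact: filter_forall.
Unshelve. all: by end_near. Qed.

(** * Finite origin from locally constant orbit types *)

Section FiniteOrigin.
Hypothesis cptX : compact [set: X].
Hypothesis clopen_nbhs : forall (x : X) (U : set X), nbhs x U ->
  exists2 V, clopen V & V x /\ V `<=` U.
Hypothesis pG : piecewise_full G.
Hypothesis near_type :
  forall x : X, \forall y \near x, orbit_type y = orbit_type x.

(* [s] exchanges the points of index [i] and [j] in each orbit meeting both
   pieces, and fixes every other point. *)
Lemma orbit_swap (i j : 'I_n) : exists s, [/\ G s,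
  (forall x, orbit_type x i -> orbit_type x j ->
    idx (s x) = tperm i j (idx x)) &
  (forall x y, orbit_type x = orbit_type y ->
    idx (s x) = idx (s y) <-> idx x = idx y)].
Proof.
pose sw x k :=
  if `[< orbit_type x i /\ orbit_type x j >] then tperm i j k else k.
have swK x : involutive (sw x).
  by move=> k; rewrite /sw; case: asboolP => // _; rewrite tpermK.
have Gid : G id by case: sG.
(* [e x] performs the exchange at the single point [x]; the swap [s] is assembled from these
   pointwise choices. *)
have /choice[e eP] : forall x, exists g, G g /\ idx (g x) = sw x (idx x).
  move=> x; rewrite /sw; case: asboolP => [[[f Gf fx] [g Gg gx]]|_].
    2: by exists id.
  by case: tpermP => [_|_|_ _]; [exists g|exists f|exists id].
pose s x := e x x.
have sE g x : G g -> idx (g x) = sw x (idx x) -> s x = g x.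
  by move=> Gg gx; have [Ge ex] := eP x; apply: (@idx_inj (e x)); rewrite ?ex.
have idx_s x : idx (s x) = sw x (idx x) by have [] := eP x.
have type_s x : orbit_type (s x) = orbit_type x.
  exact: (@orbit_type_inv (e x) x (eP x).1).
have sw_type x y : orbit_type x = orbit_type y -> sw x = sw y.
  by move=> xy; rewrite /sw xy.
(* The orbit type, [idx] and [idx] after [e x] are constant near [x], so [e x] performs the exchange
   at all nearby points too. *)
have s_near (x : X) : exists2 g, G g & \forall y \near x, s y = g y.
  have [Ge ex] := eP x; exists (e x) => //.
  near=> y; apply: sE => //.
  have -> : idx (e x y) = idx (e x x) by near: y; exact: near_idx_comp.
  rewrite ex (_ : idx y = idx x); last by near: y; exact: near_idx.
  by rewrite (sw_type y x)//; near: y; exact: near_type.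
have ss : cancel s s.
  move=> x; have [Gx _] := eP x; have [Gsx _] := eP (s x).
  apply: (idx_fix (g := e (s x) \o e x)); first exact: GM.
  by rewrite /= -/(s x) -/(s (s x)) idx_s idx_s (sw_type _ x)// swK.
(* Being an involution, [s] is its own inverse, so continuity makes it a homeomorphism. *)
have cs : continuous s.
  apply: continuous_near => x; have [g Gg sg] := s_near x.
  by exists g => //; case: (GH Gg).
exists s; split.
- rewrite -[G]pG fullE//; apply: locally_in_near => //.
  by split => //; exists s.
- by move=> x xi xj; rewrite idx_s /sw; case: asboolP => // -[].
- move=> x y /sw_type xy; rewrite !idx_s xy; split => [|->//].
  exact: (inv_inj (swK y)).
Unshelve. all: by end_near. Qed.

Lemma finite_origin : exists F, [/\ subgroup F, finite_set F & G = full F].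
Proof.
pose l x := (orbit_type x, idx x).
have finl : finite_set (range l).
  apply: sub_finite_set (finite_setX (finite_subsets
    (finite_finset (X := [set: 'I_n]))) (finite_finset (X := [set: 'I_n]))).
  by move=> _ [x _ <-].
exists (label_stab l); split.
- exact: label_stab_subgroup.
- by apply: finite_label_stab => // x y [].
apply/seteqP; split => [g Gg|]; last first.
  rewrite -[X in _ `<=` X]pG !fullE//; apply: locally_in_incr => //.
  by move=> g [].
rewrite fullE//; apply: locally_in_near => //; first exact: GH.
(* Near [x], both this swap and [g] take index [idx x] to [idx (g x)], hence they agree. *)
move=> x; have [s [Gs sij sinj]] := orbit_swap (idx x) (idx (g x)).
exists s.
  split => // y z; rewrite /l !orbit_type_inv//.
  by split => -[yz] /(sinj _ _ yz) yz'; rewrite yz yz'.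
have Tx : orbit_type x (idx x) by exists id => //; case: sG.
have Tgx : orbit_type x (idx (g x)) by exists g.
near=> y; apply: idx_inj => //.
have -> : idx (g y) = idx (g x) by near: y; exact: near_idx_comp.
have yx : idx y = idx x by near: y; exact: near_idx.
have Ty : orbit_type y = orbit_type x by near: y; exact: near_type.
by rewrite sij ?Ty// yx tpermL.
Unshelve. all: by end_near. Qed.

End FiniteOrigin.
End OrbitIndex.

(** * Existence of decompositions *)

Lemma countable_enum (T : Type) (A : set T) : countable A -> A !=set0 ->
  exists e : nat -> T, A = range e.
Proof.
move=> cA [x Ax]; have /pfcard_geP[A0|[e]] := cA.
  by move: Ax; rewrite A0.
exists e; apply/seteqP; split => [y /(@surj _ _ _ _ e)//|_ [k _ <-]].
exact: funS.
Qed.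

Lemma decomposition_exists (X : ptopologicalType) (G : set (X -> X)) (n : nat)
    (idx : X -> 'I_n) :
  subgroup G -> piecewise_full G -> countable G -> locally_finite G ->
  countable (@clopen X) ->
  (forall x : X, \forall y \near x, idx y = idx x) ->
  (forall g x, G g -> idx (g x) = idx x -> g x = x) ->
  exists Gs Bs, decomposition G Gs Bs.
Proof.
move=> sG pG cG lfG ctblX near_idx idx_fix; have [GH Gid GM GV] := sG.
have [e eE] := countable_enum cG (ex_intro _ _ Gid).
have [u uE] := countable_enum ctblX (ex_intro _ _ clopenT).
(* The pieces of [idx] are added so that atoms lie inside pieces, which gives the stabiliser
   condition; level 0 leaves them out to keep the algebra trivial. *)
pose D m : set (set X) :=
  u @` `I_m `|` [set V | (0 < m)%N /\ exists i, V = idx @^-1` [set i]].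
pose Ga m : set (X -> X) := smallest (@subgroup X) (e @` `I_m).
(* Taking all translates makes the family invariant; it stays finite because [G] is locally
   finite. *)
pose C m : set (set X) := [set g @` U | g in Ga m & U in D m].
have eG m : e @` `I_m `<=` G by rewrite eE => _ [k _ <-]; exists k.
have sGa m : subgroup (Ga m) by apply: subgroup_smallest sG (@eG m).
have GaG m : Ga m `<=` G by apply: smallest_sub => //; exact: eG.
have finGa m : finite_set (Ga m).
  by apply: lfG; [apply: finite_image; exact: finite_II|exact: eG].
have finD m : finite_set (D m).
  rewrite /D finite_setU; split; first by apply: finite_image; exact: finite_II.
  apply: sub_finite_set (finite_image (fun i => idx @^-1` [set i])
    (finite_finset (X := [set: 'I_n]))).
  by move=> _ [_ [i ->]]; exists i.
have finC m : finite_set (C m) by apply: finite_image2.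
have clD m : D m `<=` @clopen X.
  move=> _ [[k _ <-]|[_ [i ->]]]; first by rewrite uE; exists k.
  exact: clopen_idx.
have clC m : C m `<=` @clopen X.
  move=> _ [g /GaG/GH Hg] [U /clD cU] <-; exact: Homeo_image_clopen.
have subI m : `I_m `<=` `I_m.+1 by move=> k /= /ltnW.
have Gincr m : Ga m `<=` Ga m.+1.
  apply: sub_smallest2r; first exact: sGa.
  exact: image_subset.
have Cincr m : C m `<=` C m.+1.
  move=> _ [g /Gincr Gg] [U DU] <-; exists g => //; exists U => //.
  case: DU => [[k /subI kI <-]|[_ Ui]]; first by left; exists k.
  by right.
have DC m : D m `<=` C m.
  move=> U DU; exists id; first by case: (sGa m).
  by exists U => //; rewrite image_id.
have invC m : Defs.invariant (Ga m) (C m).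
  move=> g _ Gg [h Gh] [U DU <-]; exists (g \o h).
    by case: (sGa m) => _ _ + _; apply.
  by exists U => //; rewrite image_comp.
have sB m : subalgebra (saturated (C m)) by exact: saturated_subalgebra.
have finB m : finite_set (saturated (C m)) by exact: finite_saturated.
have invB m : Defs.invariant (Ga m) (saturated (C m)).
  exact: saturated_invariant.
(* This closure makes the group piecewise full on its algebra; it remains inside [G] because [G] is
   piecewise full. *)
pose Gs m := locally_in (saturated (C m)) (Ga m).
have sGs m : subgroup (Gs m) by exact: locally_in_subgroup.
have BT m : saturated (C m) setT by case: (sB m).
have GaGs m : Ga m `<=` Gs m.
  by apply: sub_locally_in => //; case: (sGa m).
have GsG m : Gs m `<=` G.
  rewrite -[X in _ `<=` X]pG => g Gsg.
  suff : full_on (saturated (C m)) (Ga m) g.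
    move=> [Hg [k [U [h [pU AU Gh gh]]]]]; split => //.
    exists k, U, h; split => //; last by move=> i; exact/GaG.
    by move=> i; have [+ _ _ _] := sB m; apply.
  by rewrite finite_full_onE.
have Ga0 : Ga 0 = [set id].
  apply/seteqP; split; last by move=> _ ->; case: (sGa 0).
  apply: smallest_sub; first exact: subgroup1.
  by rewrite II0 image_set0.
have C0 : C 0 = set0.
  by apply/seteqP; split => // _ [g _] [U [[k //]|[]//]].
have Gs0 : Gs 0 = [set id].
  apply/seteqP; split; last by move=> _ ->; case: (sGs 0).
  move=> g [_ gloc]; apply/funext => x; have [U [h [_ Ux]]] := gloc x.
  by rewrite Ga0 => -> ->.
exists Gs, (fun m => saturated (C m)); split => //.
- by move=> m; exact: finite_locally_in.
- by move=> m; apply: locally_in_incr; [exact: saturated_incr|].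
- apply/seteqP; split => [g [m _ /GsG]//|g].
  rewrite {1}eE => -[k _ <-]; exists k.+1 => //; apply/GaGs.
  by apply: sub_gen_smallest; exists k => /=.
- by move=> m; exact: saturated_incr.
- apply/seteqP; split => [V [m _ ]|V].
    by have [+ _ _ _] := sB m; apply.
  rewrite {1}uE => -[k _ <-]; exists k.+1 => //; apply: sub_saturated.
  by apply: DC; left; exists k => /=.
- by rewrite C0 saturated0.
- move=> m; split; first exact: saturated_locally_in_invariant.
  rewrite finite_full_onE//; apply/seteqP; split.
    by apply: locally_in_idem; case: (sB m).
  by apply: sub_locally_in => //; case: (sGs m).
- move=> m a [Ba a0 amin]; apply/seteqP; split => g [Gg ga];
    split => //; last first.
    apply/seteqP; split => [_ [x ax <-]|x ax]; first by rewrite ga.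
    by exists x => //; rewrite ga.
  (* At level 0 the group is trivial. Above it, an atom lies in one piece of [idx], so an element
     preserving the atom preserves the index of its points and fixes them. *)
  case: m => [|m] in Gg Ba amin *; first by move: Gg; rewrite Gs0 => ->.
  move=> x ax; apply: idx_fix; first exact: GsG Gg.
  have PB : saturated (C m.+1) (a `&` idx @^-1` [set idx x]).
    have [_ _ BI _] := sB m.+1; apply: BI Ba _; apply: sub_saturated; apply: DC.
    by right; split => //; exists (idx x).
  have [a1|aE] := amin _ PB (@subIsetl _ _ _).
    by have : set0 x by rewrite -a1.
  by have : a (g x) by [rewrite -ga; exists x]; rewrite -aE => -[].
Qed.

(** * Degrees of vertices and sizes of orbits *)

Section VertexDegree.
Variables (X : topologicalType) (G : set (X -> X)).
Variables (Gs : nat -> set (X -> X)) (Bs : nat -> set (set X)).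
Hypothesis dec : decomposition G Gs Bs.

Let sGs n : subgroup (Gs n). Proof. exact: dec_subgroup dec n. Qed.
Let sBs n : subalgebra (Bs n). Proof. exact: dec_subalgebra dec n. Qed.

Lemma atom_cell n x : atoms (Bs n) (cell (Bs n) x).
Proof.
have [_ _ _ BC] := sBs n; split; last 1 first.
- move=> b Bb bx; have [->|/set0P b0] := eqVneq b set0; first by left.
  right; apply/seteqP; split => // y xy; have [z bz] := b0.
  by apply/(xy _ Bb); apply/(bx _ bz _ Bb).
- rewrite cell_bigcap; apply: (subalgebra_fin_bigcap (sBs n)).
    exact: dec_finite_algebra dec n.
  by move=> S BS; case: asboolP => // _; exact: BC.
- by exists x.
Qed.

Lemma atom_eq_cell n a x : atoms (Bs n) a -> a x -> a = cell (Bs n) x.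
Proof.
move=> [Ba _ amin] ax.
have [Bx _ _] := atom_cell n x; have [_ _ BI _] := sBs n.
have [a0|aE] := amin _ (BI _ _ Ba Bx) (@subIsetl _ _ _).
  by have : set0 x by rewrite -a0.
apply/seteqP; split => [y|y xy]; first by rewrite -{1}aE => -[].
exact/(xy _ Ba).
Qed.

Lemma image_atom n g a : Gs n g -> atoms (Bs n) a -> atoms (Bs n) (g @` a).
Proof.
move=> Gg [Ba [x ax] amin]; have [inv _] := dec_full dec n.
have [h [Gh gK hK]] := subgroup_inv (sGs n) Gg; split.
- exact: inv.
- by exists (g x), x.
- move=> b Bb bga; have bE : b = g @` (h @` b).
    by rewrite image_comp; under eq_imagel do rewrite /= hK; rewrite image_id.
  have [|hb0|hba] := amin (h @` b) (inv _ _ Gh Bb).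
  + by move=> _ [y /bga [z az <-] <-]; rewrite gK.
  + by left; rewrite bE hb0 image_set0.
  + by right; rewrite bE hba.
Qed.

(* The stabiliser condition makes [y |-> cell (Bs n) y] a bijection from the
   orbit of [x] onto the orbit of the atom containing [x]. *)
Lemma vdeg_orbit n a x : atoms (Bs n) a -> a x ->
  vdeg Gs Bs n (vclass Gs n a) = #|` fset_set [set g x | g in Gs n]|%fset.
Proof.
move=> ata ax; have [GH Gid GM GV] := sGs n.
have finG := dec_finite_group dec n.
have cellE g : Gs n g -> cell (Bs n) (g x) = g @` a.
  by move=> Gg; apply/esym/atom_eq_cell; [exact: image_atom|exists x].
have orbE : [set b | tvertices Bs n b /\ vclass Gs n b = vclass Gs n a] =
    cell (Bs n) @` [set g x | g in Gs n].
  apply/seteqP; split => [b [atb /seteqP[ba _]]|_ [_ [g Gg <-] <-]].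
    have [g Gg gab] : vclass Gs n a b.
      by apply: ba; exists id => //; rewrite image_id.
    by exists (g x); [exists g|rewrite cellE].
  rewrite cellE//; split; first exact: image_atom.
  have [h [Gh gK hK]] := subgroup_inv (sGs n) Gg.
  apply/seteqP; split => _ [k Gk <-].
    by exists (k \o g); [exact: GM|rewrite image_comp].
  exists (k \o h); first exact: GM.
  rewrite image_comp; congr (_ @` _); apply/funext => y /=; by rewrite gK.
rewrite /vdeg orbE; apply/fcard_eq.
- by do 2 apply: finite_image.
- exact: finite_image.
apply: inj_card_eq => _ _ /set_mem[g Gg <-] /set_mem[h Gh <-].
rewrite !cellE// => gha; have [h' [Gh' hK h'K]] := subgroup_inv (sGs n) Gh.
(* If [g] and [h] send the atom to the same atom, then [h' \o g] stabilises it, hence fixes [x]. *)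
have : setwise_stab (Gs n) a (h' \o g).
  split; first exact: GM.
  rewrite -image_comp gha image_comp; under eq_imagel do rewrite /= hK.
  exact: image_id.
rewrite (dec_stab dec ata) => -[_ /(_ _ ax) /= hgx].
by rewrite -[in RHS]hgx h'K.
Qed.

Lemma finite_sub_level F : finite_set F -> F `<=` G -> exists N, F `<=` Gs N.
Proof.
move=> finF; rewrite -(dec_group_union dec).
by apply: finite_sub_bigcup_incr => //; exact: dec_group_incr dec.
Qed.

Lemma group_mono m n : (m <= n)%N -> Gs m `<=` Gs n.
Proof.
move=> /subnK <-; elim: (n - m)%N => // k IH g /IH; exact: (dec_group_incr dec).
Qed.

Lemma dpath_le (TV TE : Type) (B : bratteli TV TE) n v m u :
  dpath B n v m u -> (n <= m)%N.
Proof. by elim=> // k w e z _ nk _ _ _; exact: leqW. Qed.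

(** The two atoms of an edge share a point, and both degrees count its orbit, at consecutive levels
    from [N] on. *)
Lemma vdeg_dpath_const N :
  (forall m x, (N <= m)%N -> [set g x | g in Gs m] = [set g x | g in G]) ->
  forall v m u, dpath (associated_bratteli Gs Bs) N v m u ->
    vdeg Gs Bs N v = vdeg Gs Bs m u.
Proof.
move=> orbN v m u; elim=> // k w e z Nw -> _ _; have Nk := dpath_le Nw.
move=> [[a b] [[/= ata atb ba] _ <- <-]]; have [_ [x bx] _] := atb.
by rewrite (vdeg_orbit ata (ba _ bx)) (vdeg_orbit atb bx) !orbN// leqW.
Qed.

(** The cells of [x] decrease with the level, so consecutive ones span an edge. *)
Lemma dpath_cells x N m : (N <= m)%N ->
  dpath (associated_bratteli Gs Bs) N (vclass Gs N (cell (Bs N) x))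
    m (vclass Gs m (cell (Bs m) x)).
Proof.
move=> /subnK <-; elim: (m - N)%N => [|k IH].
  by apply: dpath_nil; exists (cell (Bs N) x) => //; exact: atom_cell.
have te : tedges Bs (k + N) (cell (Bs (k + N)) x, cell (Bs (k + N).+1) x).
  split; [exact: atom_cell..|] => y xy S BS.
  by apply: xy; exact: (dec_algebra_incr dec).
apply: (dpath_rcons IH
  (e := eclass Gs (k + N) (cell (Bs (k + N)) x, cell (Bs (k + N).+1) x))).
- by eexists; [exact: te|].
- by exists (cell (Bs (k + N).+1) x) => //; exact: atom_cell.
- by exists (cell (Bs (k + N)) x, cell (Bs (k + N).+1) x).
Qed.

Lemma orbit_of_vdeg_const N :
  (forall v, vertices (associated_bratteli Gs Bs) N v ->
    forall m u, dpath (associated_bratteli Gs Bs) N v m u ->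
      vdeg Gs Bs N v = vdeg Gs Bs m u) ->
  forall x, [set g x | g in G] = [set g x | g in Gs N].
Proof.
move=> vN x; apply/seteqP; split => [_ [g Gg <-]|_ [g Gg <-]]; last first.
  by exists g => //; rewrite -(dec_group_union dec); exists N.
have [m Nm Gmg] : exists2 m, (N <= m)%N & Gs m g.
  move: Gg; rewrite -(dec_group_union dec) => -[m _ Gmg].
  exists (maxn N m); [exact: leq_maxl|exact: group_mono (leq_maxr _ _) _ Gmg].
have finO k : finite_set [set g x | g in Gs k].
  by apply: finite_image; exact: dec_finite_group dec k.
have : [set g x | g in Gs m] (g x) by exists g.
suff -> : [set g x | g in Gs m] = [set g x | g in Gs N] by [].
(* The orbit at level [N] is contained in the finite orbit at level [m]; constancy of the degree
   makes their sizes equal. *)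
apply/esym/(fset_set_inj (finO N) (finO m))/eqP; rewrite eqEfcard.
apply/andP; split.
  rewrite -fset_set_sub//; apply: image_subset; exact: group_mono.
have := vN _ _ _ _ (dpath_cells x Nm).
rewrite !(vdeg_orbit (atom_cell _ _) (@cell_refl _ _ x)) => ->//.
by exists (cell (Bs N) x) => //; exact: atom_cell.
Qed.

End VertexDegree.

(** * Cylinders and clopen sets of the Cantor space *)

Lemma near_cantor_coord (x : cantor_space) (k : nat) :
  \forall y \near x, y k = x k.
Proof.
have ck : {for x, continuous (proj k : cantor_space -> bool)}.
  exact: (@proj_continuous _ (fun=> bool) k).
apply: (ck [set x k]); apply: open_nbhs_nbhs; split => //.
exact: discrete_open.
Qed.

(** Each point outside an open [V] around [x] differs from [x] at some coordinate, and so do its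
    neighbours; compactness of the complement bounds these coordinates uniformly. *)
Lemma cantor_cylinder (x : cantor_space) (U : set cantor_space) : nbhs x U ->
  exists n, forall y : cantor_space, (forall k, (k < n)%N -> y k = x k) -> U y.
Proof.
rewrite nbhsE => -[V [oV Vx] VU].
have : compact (~` V).
  apply: (subclosed_compact _ cantor_space_compact) => //.
  exact: open_closedC.
move=> /compact_near_coveringP/(_ nat \oo
  (fun n (y : cantor_space) => exists2 k, (k < n)%N & y k != x k)).
case=> [|N _ cN].
  move=> y nVy; have [k yk] : exists k, y k != x k.
    apply: contrapT => /forallNP yx; apply: nVy; suff -> : y = x by [].
    by apply/funext => k; apply/eqP/negPn/negP/yx.
  exists ([set z : cantor_space | z k = y k], [set m | (k < m)%N]).
    split; last by exists k.+1.
    exact: near_cantor_coord.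
  by move=> [z m] [/= zk km]; exists k => //; rewrite zk.
exists N => y yx; apply: VU; apply: contrapT => nVy.
by have [k kN] := cN N (leqnn N) y nVy; rewrite yx// eqxx.
Qed.

Lemma cantor_second_countable : @second_countable cantor_space.
Proof.
pose cyl (s : seq bool) : set cantor_space :=
  [set y | forall k, (k < size s)%N -> y k = nth false s k].
exists (range cyl).
  exact: sub_countable (card_image_le _ _) (countableP _).
split=> [_ [s _ <-]|x U].
  rewrite openE => y ys; rewrite /interior; near=> z => k ks.
  have -> : z k = y k; last exact: ys.
  have : forall i : 'I_(size s), z i = y i.
    near: z; apply: filter_forall => i; exact: near_cantor_coord.
  by move=> /(_ (Ordinal ks)).
move=> /cantor_cylinder[n nU]; exists (cyl (mkseq x n)).
  split; first by exists (mkseq x n).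
  by move=> k; rewrite size_mkseq => kn; rewrite nth_mkseq.
move=> y /= yx; apply: nU => k kn.
by rewrite yx ?size_mkseq// nth_mkseq.
Unshelve. all: by end_near. Qed.

Lemma cantor_clopen_nbhs (x : cantor_space) (U : set cantor_space) : nbhs x U ->
  exists2 V, clopen V & V x /\ V `<=` U.
Proof.
move=> xU; have [V [Vx cV] VU] := zero_dimensional_cvg cantor_space_hausdorff
  cantor_zero_dimensional cantor_space_compact xU.
by exists V.
Qed.

(** * The cycle of implications on the Cantor space *)

Unset Implicit Arguments.

Theorem proposition4p2 (G : set (cantor_space -> cantor_space))
  (hG : subgroup G) (hud : uniformly_discrete G) (hpf : piecewise_full G) :
  [<-> ample_of_finite_origin G;
       forall (Gs : nat -> set (cantor_space -> cantor_space))
              (Bs : nat -> set (set cantor_space)),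
         decomposition G Gs Bs ->
         exists N : nat, forall v : set (set cantor_space),
           vertices (associated_bratteli Gs Bs) N v ->
           forall (m : nat) (u : set (set cantor_space)),
             dpath (associated_bratteli Gs Bs) N v m u ->
             vdeg Gs Bs N v = vdeg Gs Bs m u;
       forall U : set cantor_space,
         clopen U -> clopen (\bigcup_(g in G) g @` U)].
Proof.
have [n [idx [near_idx idx_fix]]] := uniformly_discrete_index hG hud.
have cpt := cantor_space_compact.
have ctbl := clopen_countable cpt cantor_second_countable.
(* Countability and local finiteness serve twice: to build a decomposition, and to obtain ampleness
   in (i). *)
have ctblG : countable G := countable_idx hG near_idx idx_fix ctbl.
have lfG : locally_finite G := locally_finite_idx hG idx_fix.
tfae.
- move=> [[F [sF finF GF]] _] Gs Bs dec.
  have FG : F `<=` G.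
    rewrite GF fullE//; apply: sub_locally_in; first exact: clopenT.
    by case: sF.
  have [N FN] := finite_sub_level dec finF FG.
  exists N => v _; apply: (vdeg_dpath_const dec) => m x Nm.
  apply/seteqP; split => _ [g Gg <-].
    by exists g => //; rewrite -(dec_group_union dec); exists m.
  (* At the point [x], an element of [full F] takes the value of an element of [F], which lies in
     every level from [N] on. *)
  move: Gg; rewrite GF fullE// => -[_ /(_ x)[U [h [_ Ux Fh ->//]]]].
  by exists h => //; apply: (group_mono dec Nm); exact: FN.
- have [Gs [Bs dec]] :=
    decomposition_exists hG hpf ctblG lfG ctbl near_idx idx_fix.
  move=> /(_ Gs Bs dec)[N vN] U cU.
  have orbN := orbit_of_vdeg_const dec vN.
  have -> : \bigcup_(g in G) g @` U = \bigcup_(g in Gs N) g @` U.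
    apply/seteqP; split => y [g Gg [x Ux <-]].
      have : [set g x | g in G] (g x) by exists g.
      by rewrite orbN => -[h Gh <-]; exists h => //; exists x.
    exists g; last by exists x.
    by rewrite -(dec_group_union dec); exists N.
  have [GH _ _ _] := dec_subgroup dec N.
  apply: ((fin_bigcup_closedP _).1 (conj clopen0 clopenU)).
    exact: dec_finite_group dec N.
  by move=> g /GH Hg; exact: Homeo_image_clopen.
- move=> cG; split; last first.
    split => // g Gg; exact: (clopen_fix hG near_idx idx_fix Gg).
  apply: (finite_origin hG near_idx idx_fix cpt cantor_clopen_nbhs hpf).
  exact: (near_orbit_type hG near_idx cG).
Qed.
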